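(* Let $a=(a_i)_{i\in\mathbb Z}$ be a sequence in $\Bbbk$ with dual sequence $\hat a$, and let $\omega_a\colon\mathrm{Sym}^a\to\mathrm{Sym}^{\hat a}$ be the anti-algebra isomorphism with $\omega_a(S_{k;a})=\Lambda_{k;\hat a}$ for all $k\ge1$. For every composition $I=(i_1,\ldots,i_n)$ with conjugate composition $J=I^\sim=(j_1,\ldots,j_m)$ and $d_J=j_1+\cdots+j_m$, $$\omega_a(R_{I;a})=R_{I^\sim;\hat a}^{[\,j_m-d_J+i_n-1\,]}.$$
   Context: $\Bbbk$ is a field of characteristic zero and $a=(a_i)_{i\in\mathbb Z}$ is a sequence in $\Bbbk$. Put $(t\downarrow a)^k=(t-a_1)\cdots(t-a_k)$, $(t\downarrow a)^0=1$, $(\tau^s a)_i=a_{i+s}$ for $s\in\mathbb Z$, and $\hat a_i=-a_{-i+1}$ (so $\hat{\hat a}=a$). $\mathrm{Sym}^a=\Bbbk\langle S_{1;a},S_{2;a},\ldots\rangle$ is the free associative unital $\Bbbk$-algebra on $S_{k;a}$, $k\ge1$. With $t$ a central variable and all expressions expanded as formal power series in $1/t$, put $\sigma^a(t)=\sum_{k\ge0}S_{k;a}/(t\downarrow a)^k$ and $\lambda^{\hat a}(t)=\sum_{k\ge0}\Lambda_{k;a}/(t\downarrow\hat a)^k$ with $S_{0;a}=\Lambda_{0;a}=1$; the elements $\Lambda_{k;a}\in\mathrm{Sym}^a$ are determined by $\lambda^{\hat a}(-t)\sigma^a(t)=\sigma^a(t)\lambda^{\hat a}(-t)=1$. The same definitions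 apply to $\hat a$ in place of $a$, giving $\mathrm{Sym}^{\hat a}$, $S_{k;\hat a}$, $\Lambda_{k;\hat a}$. Shifts: for $s\in\mathbb Z$, $S_{k;a}^{[s]}$ is defined by $\sum_{k\ge0} S_{k;a}^{[s]}/(t\downarrow\tau^{-s}a)^k=\sum_{k\ge0}S_{k;a}/(t\downarrow a)^k$. Quasideterminants: for an $n\times n$ matrix $A$ over a unital ring such that the matrix $A^{pq}$ (delete row $p$ and column $q$) is invertible, $|A|_{pq}=a_{pq}-r(A^{pq})^{-1}c$, where $r$ is the $p$-th row of $A$ with $a_{pq}$ removed and $c$ is the $q$-th column of $A$ with $a_{pq}$ removed. A composition is a sequence $I=(i_1,\ldots,i_n)$ of positive integers. For $K=(k_1,\ldots,k_n)\in\mathbb Z^n$ set $R_{I;a}^{[K]}=(-1)^{n-1}|M|_{1n}$, where $M_{pq}=S_{i_p+\cdots+i_q;a}^{[k_p]}$ if $p\le q$, $M_{q+1,q}=1$, $M_{pq}=0$ if $p>q+1$. With $s_k=\sum_{\nu=k}^{n-1}i_\nu$, $R_{I;a}=R_{I;a}^{[(s_1,\ldots,s_{n-1},0)]}$ and, for $s\in\mathbb Z$, $R_{I;a}^{[s]}=R_{I;a}^{[(s_1+s,\ldots,s_{n-1}+s,s)]}$. Conjugate composition: the ribbon diagram of $I$ has $i_l$ boxes in its $l$-th row (rows numbered from top to bottom), the first box of row $l+1$ lying directly below the last box of row $l$. $I^\sim=(j_1,\ldots,j_m)$ is the sequence of column heights of this diagram read from right to left (e.g. $(2,1,1)^\sim=(3,1)$,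 $(1,3,2,1)^\sim=(2,2,1,2)$). *)

(* Defs.v *)
From HB Require Import structures.
From mathcomp Require Import all_boot all_order all_algebra.
From mathcomp Require Import finmap monalg.
From Stdlib Require Import ClassicalEpsilon.

Set Implicit Arguments.
Unset Strict Implicit.
Unset Printing Implicit Defensive.

Import GRing.Theory.

Local Open Scope ring_scope.

(* A formal power series in 1/t with coefficients in A is a function
   f : nat -> A, with f n the coefficient of t^(-n). *)

Section Series.
Variable A : nzRingType.

Definition ser_one : nat -> A := fun n => (n == 0%N)%:R.

Definition ser_mul (f g : nat -> A) : nat -> A :=
  fun n => \sum_(i < n.+1) f i * g (n - i)%N.

(* f(t) |-> f(-t) *)
Definition ser_negt (f : nat -> A) : nat -> A := fun n => (-1) ^+ n * f n.

End Series.

Section Sequences.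
Variable K : fieldType.

(* 1/(t - c) = \sum_(m >= 0) c^m t^(-m-1) *)
Definition ser_invlin (c : K) : nat -> K :=
  fun n => if n is m.+1 then c ^+ m else 0.

(* The expansion of 1/((t - a_1) ... (t - a_k)) in 1/t. *)
Fixpoint inv_ffact (a : int -> K) (k : nat) : nat -> K :=
  if k is k'.+1 then ser_mul (inv_ffact a k') (ser_invlin (a k%:Z))
  else ser_one K.

(* \sum_(k >= 0) c_k / ((t - a_1) ... (t - a_k)); since the k-th term has no
   coefficient in t^(-n) for n < k, only k <= n contributes to t^(-n). *)
Definition ffact_series (A : lmodType K) (a : int -> K) (c : nat -> A) :
    nat -> A :=
  fun n => \sum_(k < n.+1) inv_ffact a k n *: c k.

Definition shift_seq (s : int) (a : int -> K) : int -> K :=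
  fun i => a (i + s).

Definition hat (a : int -> K) : int -> K := fun i => - a (- i + 1).

End Sequences.

Section SeriesTheory.
Variable A : nzRingType.
Implicit Types f g h : nat -> A.

Lemma strong_rec (F : seq A -> A) : exists c, forall n, c n = F (mkseq c n).
Proof.
pose g n := iter n (fun s => rcons s (F s)) [::].
exists (fun n => F (g n)) => n; congr F.
by elim: n => // n IHn; rewrite mkseqS -IHn.
Qed.

Lemma ser_mul_poly f g N n : (n < N)%N ->
  ser_mul f g n = (\poly_(i < N) f i * \poly_(i < N) g i)`_n.
Proof.
move=> ltnN; rewrite coefM; apply: eq_bigr => i _.
have ltiN : (i < N)%N by rewrite (leq_ltn_trans _ ltnN) // -ltnS.
by rewrite !coef_poly ltiN (leq_ltn_trans (leq_subr i n) ltnN).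
Qed.

Lemma ser_mulA f g h : ser_mul f (ser_mul g h) =1 ser_mul (ser_mul f g) h.
Proof.
move=> n; pose P u := \poly_(i < n.+1) (u i : A).
transitivity ((P f * P g * P h)`_n).
  rewrite -mulrA coefM; apply: eq_bigr => i _.
  rewrite coef_poly ltn_ord (@ser_mul_poly _ _ n.+1) //.
  by rewrite ltnS leq_subr.
rewrite coefM; apply: eq_bigr => i _.
by rewrite -ser_mul_poly // coef_poly ltnS leq_subr.
Qed.

Lemma eq_ser_mul f f' g g' : f =1 f' -> g =1 g' ->
  ser_mul f g =1 ser_mul f' g'.
Proof. by move=> ef eg n; apply: eq_bigr => i _; rewrite ef eg. Qed.

Lemma ser_mul1 f : ser_mul f (ser_one A) =1 f.
Proof.
move=> n; rewrite /ser_mul big_ord_recr /= subnn mulr1 big1 ?add0r // => i _.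
by rewrite /ser_one subn_eq0 leqNgt ltn_ord mulr0.
Qed.

Lemma ser_1mul f : ser_mul (ser_one A) f =1 f.
Proof.
move=> n; rewrite /ser_mul big_ord_recl /= subn0 mul1r big1 ?addr0 // => i _.
by rewrite mul0r.
Qed.

Lemma ser_inv_uniq f g h : ser_mul g f =1 ser_one A ->
  ser_mul f h =1 ser_one A -> g =1 h.
Proof.
move=> gf fh n; rewrite -(ser_mul1 g n) -(ser_1mul h n).
rewrite -(eq_ser_mul gf (frefl h) n) -(eq_ser_mul (frefl g) fh n).
exact: ser_mulA.
Qed.

Lemma ser_inv_exists f : f 0%N = 1 ->
  exists g, ser_mul f g =1 ser_one A /\ ser_mul g f =1 ser_one A.
Proof.
move=> f0.
have right : exists g, ser_mul f g =1 ser_one A.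
  have [g gE] := strong_rec (fun s => (size s == 0%N)%:R
    - \sum_(i < size s) f i.+1 * nth 0 s (size s - i.+1)).
  exists g => n; rewrite /ser_mul big_ord_recl /= f0 mul1r subn0 [g n]gE.
  rewrite size_mkseq -addrA -[RHS]addr0; congr +%R; apply/eqP.
  rewrite addrC subr_eq0; apply/eqP; apply: eq_bigr => i _.
  by rewrite nth_mkseq // ltn_subrL (leq_ltn_trans _ (ltn_ord i)).
have left : exists g, ser_mul g f =1 ser_one A.
  have [g gE] := strong_rec (fun s => (size s == 0%N)%:R
    - \sum_(i < size s) nth 0 s i * f (size s - i)%N).
  exists g => n; rewrite /ser_mul big_ord_recr /= subnn f0 mulr1 [g n]gE.
  rewrite size_mkseq addrC -addrA -[RHS]addr0; congr +%R; apply/eqP.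
  rewrite addrC subr_eq0; apply/eqP; apply: eq_bigr => i _.
  by rewrite nth_mkseq.
have [[g fg] [h hf]] := (right, left).
exists g; split=> // n.
by rewrite -(eq_ser_mul (ser_inv_uniq hf fg) (frefl f) n) hf.
Qed.

Lemma ser_negtK f : ser_negt (ser_negt f) =1 f.
Proof. by move=> n; apply: signrMK. Qed.

End SeriesTheory.

Section FFactTheory.
Variables (K : fieldType) (a : int -> K).

Lemma inv_ffact_lt k n : (n < k)%N -> inv_ffact a k n = 0.
Proof.
elim: k n => // k IHk n; rewrite ltnS => lenk.
rewrite [inv_ffact _ _]/= /ser_mul big1 // => i _.
case: (ltngtP i n) => [ltin|ltni|->]; last by rewrite subnn mulr0.
  by rewrite IHk ?mul0r // (leq_trans ltin).
by have := ltn_ord i; rewrite ltnS leqNgt ltni.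
Qed.

Lemma inv_ffact_diag k : inv_ffact a k k = 1.
Proof.
elim: k => // k IHk; rewrite [inv_ffact _ _]/= /ser_mul !big_ord_recr /=.
rewrite subnn mulr0 addr0 subSnn /= IHk mulr1 big1 ?add0r // => i _.
by rewrite inv_ffact_lt ?mul0r.
Qed.

Variable A : lmodType K.
Implicit Types c d f : nat -> A.

Lemma ffact_series_rec c n :
  ffact_series a c n = \sum_(k < n) inv_ffact a k n *: c k + c n.
Proof. by rewrite /ffact_series big_ord_recr /= inv_ffact_diag scale1r. Qed.

Lemma ffact_series0 c : ffact_series a c 0%N = c 0%N.
Proof. by rewrite ffact_series_rec big_ord0 add0r. Qed.

Lemma ffact_series_inj c d :
  ffact_series a c =1 ffact_series a d -> c =1 d.
Proof.
move=> cd n; elim/ltn_ind: n => n IHn.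
have := cd n; rewrite !ffact_series_rec.
rewrite (eq_bigr (fun k : 'I_n => inv_ffact a k n *: d k)); last first.
  by move=> k _; rewrite IHn.
exact: addrI.
Qed.

Lemma ffact_series_uniq f c d :
  ffact_series a c =1 f -> ffact_series a d =1 f -> c =1 d.
Proof. by move=> cE dE; apply: ffact_series_inj => n; rewrite cE dE. Qed.

End FFactTheory.

Lemma ffact_series_surj (K : fieldType) (a : int -> K) (A : algType K)
    (f : nat -> A) : exists c, ffact_series a c =1 f.
Proof.
have [c cE] := strong_rec (fun s : seq A => f (size s)
  - \sum_(k < size s) inv_ffact a k (size s) *: nth 0 s k).
exists c => n; rewrite ffact_series_rec cE size_mkseq addrC -addrA.
rewrite -[RHS]addr0; congr +%R; apply/eqP.
rewrite addrC subr_eq0; apply/eqP; apply: eq_bigr => k _.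
by rewrite nth_mkseq.
Qed.

Section DualSeries.
Variables (K : fieldType) (b : int -> K) (A : algType K).
Implicit Types f L : nat -> A.

(* With lambda(t) the series with coefficients L_k over the sequence b, the
   identities lambda(-t) f(t) = f(t) lambda(-t) = 1. *)
Definition is_dual f L : Prop :=
  let lambda_neg := ser_negt (ffact_series b L) in
  [/\ L 0%N = 1, ser_mul lambda_neg f =1 ser_one A &
      ser_mul f lambda_neg =1 ser_one A].

Lemma is_dual_exists f : f 0%N = 1 -> exists L, is_dual f L.
Proof.
move=> f0; have [g [fg gf]] := ser_inv_exists f0.
have [L LE] := ffact_series_surj b (ser_negt g).
have negE : ser_negt (ffact_series b L) =1 g.
  by move=> n; rewrite -[RHS]ser_negtK /ser_negt LE.
exists L; split.
- have := fg 0%N; rewrite /ser_mul big_ord1 subnn f0 mul1r => g0.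
  by rewrite -(ffact_series0 b) LE /ser_negt g0 mul1r.
- by move=> n; rewrite (eq_ser_mul negE (frefl _)) gf.
- by move=> n; rewrite (eq_ser_mul (frefl _) negE) fg.
Qed.

Lemma is_dual_uniq f L L' : is_dual f L -> is_dual f L' -> L =1 L'.
Proof.
case=> _ lL _ [_ _ rL']; apply: (@ffact_series_inj _ b) => n.
rewrite -[LHS]ser_negtK -[RHS]ser_negtK.
by congr (_ * _); apply: (ser_inv_uniq lL rL').
Qed.

End DualSeries.

Lemma malg_scalerAr (K : fieldType) (M : monomType) (c : K)
    (x y : {malg K[M]}) : c *: (x * y) = x * (c *: y).
Proof.
pose E := (msupp x `|` msupp y `|` msupp (c *: y))%fset.
have lex : (msupp x `<=` E)%fset by rewrite /E -fsetUA fsubsetUl.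
have ley : (msupp y `<=` E)%fset.
  by rewrite /E; apply: fsubset_trans (fsubsetUl _ _); apply: fsubsetUr.
have lez : (msupp (c *: y) `<=` E)%fset by rewrite /E fsubsetUr.
apply/malgP=> k; rewrite mcoeffZ (malgMEw lex ley) (malgMEw lex lez).
rewrite !raddf_sum mulr_sumr; apply: eq_bigr => i _ /=.
rewrite !raddf_sum mulr_sumr; apply: eq_bigr => j _ /=.
by rewrite !mcoeffU mcoeffZ mulrnAr mulrCA.
Qed.

(* The free associative algebra, as the algebra of the free monoid on nat; the
   letter k stands for the generator with index k + 1.  The sequence a only
   serves to keep the algebras attached to different sequences apart. *)
Definition Sym (K : fieldType) (a : int -> K) : Type := {malg K[{fmonom nat}]}.

HB.instance Definition _ (K : fieldType) (a : int -> K) :=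
  GRing.Lalgebra.on (Sym a).

Lemma Sym_scalerAr (K : fieldType) (a : int -> K) (c : K) (x y : Sym a) :
  c *: (x * y) = x * (c *: y).
Proof. exact: malg_scalerAr. Qed.

HB.instance Definition _ (K : fieldType) (a : int -> K) :=
  GRing.Lalgebra_isAlgebra.Build K (Sym a) (@Sym_scalerAr K a).

Section Generators.
Variables (K : fieldType) (a : int -> K).

Definition symS (k : nat) : Sym a := if k is k'.+1 then << fmu k' >> else 1.

Definition sigma : nat -> Sym a := ffact_series a symS.

Definition is_Lambda (L : nat -> Sym a) : Prop := is_dual (hat a) sigma L.

Definition symL : nat -> Sym a := epsilon (inhabits (fun=> 0)) is_Lambda.

Definition is_shift (s : int) (c : nat -> Sym a) : Prop :=
  ffact_series (shift_seq (- s) a) c =1 sigma.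

Definition symS_shift (s : int) : nat -> Sym a :=
  epsilon (inhabits (fun=> 0)) (is_shift s).

Lemma sigma0 : sigma 0%N = 1. Proof. exact: ffact_series0. Qed.

Lemma is_Lambda_exists : exists L, is_Lambda L.
Proof. exact: is_dual_exists sigma0. Qed.

Lemma is_Lambda_uniq L L' : is_Lambda L -> is_Lambda L' -> L =1 L'.
Proof. exact: is_dual_uniq. Qed.

Lemma symLP : is_Lambda symL.
Proof. exact: epsilon_spec is_Lambda_exists. Qed.

Lemma is_shift_uniq s c c' : is_shift s c -> is_shift s c' -> c =1 c'.
Proof. exact: ffact_series_uniq. Qed.

Lemma symS_shiftP s : is_shift s (symS_shift s).
Proof. by apply: epsilon_spec; apply: ffact_series_surj. Qed.

End Generators.

Definition is_mxinv (R : nzRingType) n (A B : 'M[R]_n) : Prop :=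
  A *m B = 1%:M /\ B *m A = 1%:M.

(* The two-sided inverse of a matrix over a noncommutative ring (an arbitrary
   matrix when A is not invertible). *)
Definition mxinv (R : nzRingType) n (A : 'M[R]_n) : 'M[R]_n :=
  epsilon (inhabits 0) (is_mxinv A).

Lemma mxinv_eq (R : nzRingType) n (A B : 'M[R]_n) :
  is_mxinv A B -> mxinv A = B.
Proof.
move=> AB; have [_ XA] : is_mxinv A (mxinv A).
  by apply: epsilon_spec; exists B.
by rewrite -[LHS]mulmx1 -(proj1 AB) mulmxA XA mul1mx.
Qed.

Lemma unitriangular_inv (R : nzRingType) n (A : 'M[R]_n) :
    (forall i : 'I_n, A i i = 1) ->
    (forall i j : 'I_n, (j < i)%N -> A i j = 0) ->
  exists B, is_mxinv A B.
Proof.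
move=> A1 A0; pose X := 1%:M - A; pose pw j := iter j (mulmx X) 1%:M.
have X0 (i j : 'I_n) : (j <= i)%N -> X i j = 0.
  rewrite !mxE; case: (ltngtP j i) => // [ltji|eqij] _.
    by rewrite A0 // subr0 -val_eqE /= gtn_eqF.
  by rewrite (val_inj eqij) A1 eqxx subrr.
have pw0 k (i j : 'I_n) : (j < i + k)%N -> pw k i j = 0.
  elim: k i j => [|k IHk] i j.
    by rewrite addn0 mxE -val_eqE /= => ltji; rewrite gtn_eqF.
  rewrite /= mxE => ltj; apply: big1 => l _.
  case: (leqP l i) => [/X0 -> | ltil]; first by rewrite mul0r.
  rewrite [X in _ * X](IHk l j) ?mulr0 // (leq_trans ltj) //.
  by rewrite addnS -addSn leq_add2r.
have pwn : pw n = 0.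
  by apply/matrixP=> i j; rewrite pw0 ?mxE // ltn_addl.
have pwC k : pw k *m X = pw k.+1.
  elim: k => [|k IHk]; first by rewrite /= mul1mx mulmx1.
  by rewrite {1}/pw /= -mulmxA [_ *m X]IHk.
have AE : A = 1%:M - X by rewrite opprB addrC subrK.
have tel : \sum_(0 <= k < n) (pw k - pw k.+1) = 1%:M.
  rewrite (@telescope_sumr_eq _ _ _ (fun k => - pw k)) // ?pwn.
    by rewrite oppr0 sub0r opprK.
  by move=> k _; rewrite opprK addrC.
exists (\sum_(k < n) pw k); split.
  rewrite AE mulmxBl mul1mx mulmx_sumr -sumrB.
  by rewrite -tel (big_mkord xpredT (fun k => pw k - pw k.+1)).
rewrite AE mulmxBr mulmx1 mulmx_suml -sumrB.
rewrite (eq_bigr (fun k : 'I_n => pw k - pw k.+1)) => [|k _]; last by rewrite pwC.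
by rewrite -tel (big_mkord xpredT (fun k => pw k - pw k.+1)).
Qed.

Definition quasidet (R : nzRingType) n (A : 'M[R]_n) (p q : 'I_n) : R :=
  A p q - (col' q (row p A) *m mxinv (row' p (col' q A))
            *m row' p (col q A)) 0 0.

(* Compositions are sequences of positive integers, and are nonempty. *)
Definition is_comp (I : seq nat) : bool :=
  (I != [::]) && all (fun i => 0 < i)%N I.

Section Ribbons.
Variables (K : fieldType) (a : int -> K) (I : seq nat).

(* Rows, columns and parts are numbered from 0 here, and the matrix has size
   n = size I for nonempty I. *)
Definition ribbon_mx (k : 'I_(size I).-1.+1 -> int) :
    'M[Sym a]_((size I).-1.+1) :=
  \matrix_(p, q)
    if (p <= q)%N then symS_shift a (k p) (\sum_(p <= v < q.+1) nth 0 I v)%N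
    else if p == q.+1 :> nat then 1 else 0.

Lemma ribbon_minor_inv (k : 'I_(size I).-1.+1 -> int) :
  exists B, is_mxinv (row' ord0 (col' ord_max (ribbon_mx k))) B.
Proof.
have bumpE (q : 'I_(size I).-1) : bump (size I).-1 q = q.
  by rewrite /bump leqNgt ltn_ord.
apply: unitriangular_inv => [i|i j ltji]; rewrite !mxE /= bumpE /bump /= !add1n.
  by rewrite ltnn eqxx.
by rewrite ltnNge (ltnW ltji) eqSS gtn_eqF.
Qed.

Definition ribbonK (k : 'I_(size I).-1.+1 -> int) : Sym a :=
  (-1) ^+ (size I).-1 * quasidet (ribbon_mx k) ord0 ord_max.

(* i_(p+1) + ... + i_(n-1) in the numbering from 1; it is 0 for p = n - 1. *)
Definition part_sum (p : nat) : nat :=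
  (\sum_(p <= v < (size I).-1) nth 0 I v)%N.

Definition ribbon : Sym a := ribbonK (fun p => (part_sum p)%:Z).

Definition ribbon_shift (s : int) : Sym a :=
  ribbonK (fun p => (part_sum p)%:Z + s).

End Ribbons.

(* Leftmost column of row l of the ribbon diagram: consecutive rows share
   exactly one column. *)
Definition row_start (I : seq nat) (l : nat) : nat :=
  sumn [seq i.-1 | i <- take l I].

Definition ncols (I : seq nat) : nat := (row_start I (size I)).+1.

Definition col_height (I : seq nat) (c : nat) : nat :=
  count (fun l => row_start I l <= c < row_start I l + nth 0 I l)%N
        (iota 0 (size I)).

Definition conj_comp (I : seq nat) : seq nat :=
  rev [seq col_height I c | c <- iota 0 (ncols I)].

Example conj_comp_211 : conj_comp [:: 2; 1; 1] = [:: 3; 1]. Proof. by []. Qed.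
Example conj_comp_1321 : conj_comp [:: 1; 3; 2; 1] = [:: 2; 2; 1; 2].
Proof. by []. Qed.

Definition anti_algebra_hom (K : fieldType) (A B : algType K) (w : A -> B) :
    Prop :=
  [/\ linear w, w 1 = 1 & {morph w : x y / x * y >-> y * x}].

Definition anti_algebra_iso (K : fieldType) (A B : algType K) (w : A -> B) :
    Prop :=
  anti_algebra_hom w /\ bijective w.

Section AntiHomTheory.
Variables (K : fieldType) (A B : algType K) (w : A -> B).
Hypothesis w_hom : anti_algebra_hom w.

Lemma anti_hom_sum (n : nat) (F : nat -> A) :
  w (\sum_(i < n) F i) = \sum_(i < n) w (F i).
Proof.
have [wL _ _] := w_hom.
have w0 : w 0 = 0.
  by have := wL (-1) 0 0; rewrite scaler0 addr0 scaleN1r addNr.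
elim: n => [|n IHn]; first by rewrite !big_ord0.
by rewrite !big_ord_recr /= addrC -[F n]scale1r wL IHn !scale1r addrC.
Qed.

Lemma anti_homZ c x : w (c *: x) = c *: w x.
Proof.
have [wL _ _] := w_hom.
have w0 : w 0 = 0.
  by have := wL (-1) 0 0; rewrite scaler0 addr0 scaleN1r addNr.
by rewrite -[c *: x]addr0 wL w0 addr0.
Qed.

Lemma anti_hom_ffact (b : int -> K) c n :
  w (ffact_series b c n) = ffact_series b (fun k => w (c k)) n.
Proof.
rewrite /ffact_series (anti_hom_sum _ (fun k => inv_ffact b k n *: c k)).
by apply: eq_bigr => k _; rewrite anti_homZ.
Qed.

Lemma anti_hom_ser_mul f g n :
  w (ser_mul f g n) = ser_mul (fun i => w (g i)) (fun i => w (f i)) n.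
Proof.
have [_ _ wM] := w_hom.
rewrite /ser_mul (anti_hom_sum _ (fun i => f i * g (n - i)%N)).
rewrite (reindex_inj rev_ord_inj) /=; apply: eq_bigr => i _.
by rewrite wM subSS subKn // -ltnS.
Qed.

Lemma anti_hom_negt f n : w (ser_negt f n) = ser_negt (fun i => w (f i)) n.
Proof.
rewrite /ser_negt -(signr_odd A) -(signr_odd B).
case: (odd n); rewrite ?expr0 ?mul1r // !expr1 !mulN1r -!scaleN1r.
by rewrite anti_homZ.
Qed.

Lemma anti_hom_one n : w (ser_one A n) = ser_one B n.
Proof.
have [_ w1 _] := w_hom; rewrite /ser_one; case: eqP => //= _.
by rewrite -[0%:R](scale0r 1) anti_homZ scale0r.
Qed.

End AntiHomTheory.

Lemma ser_negt_mul (A : nzRingType) (f g : nat -> A) :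
  ser_mul (ser_negt f) (ser_negt g) =1 ser_negt (ser_mul f g).
Proof.
move=> n; rewrite /ser_negt /ser_mul mulr_sumr; apply: eq_bigr => i _.
rewrite !mulrA -[_ * _ * _ ^+ _]mulrA (commr_sign (f i)) mulrA -exprD.
by rewrite subnKC // -ltnS.
Qed.

Lemma ser_negt_one (A : nzRingType) : ser_negt (ser_one A) =1 ser_one A.
Proof.
by move=> [|n]; rewrite /ser_negt /ser_one ?mul1r //= mulr0.
Qed.

Lemma eq_ffact_series (K : fieldType) (A : lmodType K) (a b : int -> K)
    (c d : nat -> A) : a =1 b -> c =1 d ->
  ffact_series a c =1 ffact_series b d.
Proof.
move=> ab cd n; have eq_inv k m : inv_ffact a k m = inv_ffact b k m.
  elim: k m => // k IHk m.
  by rewrite /= ab; apply: eq_bigr => i _; rewrite IHk.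
by apply: eq_bigr => k _; rewrite cd eq_inv.
Qed.

Lemma eq_ser_negt (A : nzRingType) (f g : nat -> A) :
  f =1 g -> ser_negt f =1 ser_negt g.
Proof. by move=> fg n; rewrite /ser_negt fg. Qed.

Lemma anti_hom_dual (K : fieldType) (A B : algType K) (w : A -> B)
    (a b a' b' : int -> K) (S L : nat -> A) (S' L' : nat -> B) :
    anti_algebra_hom w -> a =1 a' -> b =1 b' ->
    is_dual b (ffact_series a S) L -> is_dual a' (ffact_series b' S') L' ->
    (forall k, w (S k) = L' k) ->
  forall k, w (L k) = S' k.
Proof.
move=> w_hom aa' bb' [_ LS SL] [_ LS' SL'] wS.
apply: (@ffact_series_inj _ b) => n.
rewrite [RHS](eq_ffact_series bb' (frefl S')).
rewrite -[LHS]ser_negtK -[RHS]ser_negtK; congr (_ * _).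
pose lam := ffact_series a' L'.
have wlam m : w (ffact_series a S m) = lam m.
  by rewrite anti_hom_ffact //; apply: eq_ffact_series.
have negE m : w (ser_negt (ffact_series b L) m)
    = ser_negt (ffact_series b (fun k => w (L k))) m.
  rewrite anti_hom_negt //; apply: eq_ser_negt => {}m.
  exact: anti_hom_ffact.
apply: (@ser_inv_uniq _ lam) => m.
  rewrite -(anti_hom_one w_hom) -SL anti_hom_ser_mul //; apply: eq_ser_mul.
    by move=> i; rewrite negE.
  by move=> i; rewrite wlam.
rewrite -[RHS]ser_negt_one -(eq_ser_negt LS') -[RHS]ser_negt_mul.
by apply: eq_ser_mul => // i; rewrite [RHS]ser_negtK.
Qed.

Section FreeAlgebra.
Variables (K : fieldType) (B : algType K).

Definition word_prod (v : nat -> B) (m : {fmonom nat}) : B :=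
  \prod_(i <- rev m) v i.

Definition anti_ext (v : nat -> B) (x : {malg K[{fmonom nat}]}) : B :=
  \sum_(m <- msupp x) x@_m *: word_prod v m.

Lemma anti_ext_mmap v x : anti_ext v x = mmap (in_alg B) (word_prod v) x.
Proof. by apply: eq_bigr => m _; rewrite mulr_algl. Qed.

Lemma anti_ext_linear v : linear (anti_ext v).
Proof.
move=> c x y; rewrite !anti_ext_mmap raddfD; congr (_ + _).
rewrite /= (mmapEw (msuppZ_le _ _)) mmapE scaler_sumr.
by apply: eq_bigr => m _; rewrite mcoeffZ !mulr_algl scalerA.
Qed.

Lemma anti_extU v c m : anti_ext v << c *g m >> = c *: word_prod v m.
Proof. by rewrite anti_ext_mmap mmapU /= mulr_algl. Qed.

Lemma anti_ext_gen v k : anti_ext v << fmu k >> = v k.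
Proof. by rewrite anti_extU scale1r /word_prod fmU big_seq1. Qed.

Lemma anti_ext1 v : anti_ext v 1 = 1.
Proof. by rewrite anti_extU scale1r /word_prod fm1 big_nil. Qed.

Lemma anti_extM v : {morph anti_ext v : x y / x * y >-> y * x}.
Proof.
move=> x y; rewrite malgME !anti_ext_mmap raddf_sum.
rewrite [mmap _ _ x in RHS]mmapE mulr_sumr; apply: eq_bigr => i _.
rewrite raddf_sum mmapE mulr_suml; apply: eq_bigr => j _.
rewrite /= mmapU /word_prod fmM rev_cat big_cat /=.
by rewrite !mulr_algl -scalerAr -scalerAl scalerA.
Qed.

End FreeAlgebra.

Lemma free_algebra_ind (K : fieldType) (P : {malg K[{fmonom nat}]} -> Prop) :
    (forall c x y, P x -> P y -> P (c *: x + y)) -> P 1 ->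
    (forall x y, P x -> P y -> P (x * y)) ->
    (forall k, P << fmu k >>) ->
  forall x, P x.
Proof.
move=> PD P1 PM Pg x.
have P0 : P 0 by have := PD (-1) 1 1 P1 P1; rewrite scaleN1r addNr.
have Pw s : P << FMonom s >>.
  elim: s => [|k s IHs]; first by rewrite -fmoneE.
  have -> : << FMonom (k :: s) >> = << fmu k >> * << FMonom s >>
      :> {malg K[{fmonom nat}]}.
    by rewrite malgM_def fgmulUU mul1r /mmul /= fmmulE fmuE.
  exact: PM.
rewrite (monalgE x); elim: (enum_fset _) => [|m s IHs].
  by rewrite big_nil.
rewrite big_cons.
have -> : << x@_m *g m >> = x@_m *: << m >> :> {malg K[{fmonom nat}]}.
  by apply/malgP => k; rewrite mcoeffZ !mcoeffU mulrnAr mulr1.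
by apply: PD => //; case: m => ?.
Qed.

Lemma anti_ext_hom (K : fieldType) (B : algType K) (a : int -> K)
    (v : nat -> B) : anti_algebra_hom (anti_ext v : Sym a -> B).
Proof.
by split; [exact: anti_ext_linear | exact: anti_ext1 | exact: anti_extM].
Qed.

Lemma anti_hom_cancel (K : fieldType) (B : algType K) (a : int -> K)
    (u : Sym a -> B) (v : B -> Sym a) :
    anti_algebra_hom u -> anti_algebra_hom v ->
    (forall k, v (u (symS a k)) = symS a k) ->
  cancel u v.
Proof.
move=> [uL u1 uM] [vL v1 vM] vu; apply: free_algebra_ind.
- by move=> c x y vux vuy; rewrite uL vL vux vuy.
- by rewrite u1 v1.
- by move=> x y vux vuy; rewrite uM vM vux vuy.
- by move=> k; apply: (vu k.+1).
Qed.

Lemma anti_algebra_iso_exists (K : fieldType) (a : int -> K) :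
  exists w : Sym a -> Sym (hat a), anti_algebra_iso w /\
    forall k : nat, (1 <= k)%N -> w (symS a k) = symL (hat a) k.
Proof.
pose w : Sym a -> Sym (hat a) := anti_ext (fun k => symL (hat a) k.+1).
pose v : Sym (hat a) -> Sym a := anti_ext (fun k => symL a k.+1).
have w_hom : anti_algebra_hom w by apply: anti_ext_hom.
have v_hom : anti_algebra_hom v by apply: anti_ext_hom.
have [La0 _ _] := symLP a; have [Lh0 _ _] := symLP (hat a).
have wS k : w (symS a k) = symL (hat a) k.
  case: k => [|k]; first by rewrite Lh0; have [_ ->] := w_hom.
  exact: anti_ext_gen.
have vS k : v (symS (hat a) k) = symL a k.
  case: k => [|k]; first by rewrite La0; have [_ ->] := v_hom.
  exact: anti_ext_gen.
have hatK : hat (hat a) =1 a.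
  by move=> i; rewrite /hat opprK opprD opprK addrK.
have wL k : w (symL a k) = symS (hat a) k.
  exact: (anti_hom_dual w_hom (fsym hatK) (frefl _) (symLP a) (symLP (hat a)) wS).
have vL k : v (symL (hat a) k) = symS a k.
  exact: (anti_hom_dual v_hom (frefl _) hatK (symLP (hat a)) (symLP a) vS).
exists w; split=> //; split=> //; exists v.
  have vw k : v (w (symS a k)) = symS a k.
    by rewrite wS vL.
  exact: (anti_hom_cancel w_hom v_hom vw).
have wv k : w (v (symS (hat a) k)) = symS (hat a) k by rewrite vS wL.
exact: (anti_hom_cancel v_hom w_hom wv).
Qed.

(* Main.v *)
Require Import Defs.
From mathcomp Require Import all_boot all_order all_algebra.
From mathcomp Require Import zify ring.

Set Implicit Arguments.
Unset Strict Implicit.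
Unset Printing Implicit Defensive.

Import GRing.Theory.

Local Open Scope ring_scope.

(** The proof replaces shifted generators by points on a line.  Write h(x, k) =
    S_k^[-x]; it is the coefficient of 1/((t - a_(x+1)) ... (t - a_(x+k))) in
    the expansion of sigma^a(t) that starts at x, so h(x, k) belongs to the
    interval from x to x + k.  With the shifts occurring in R_I, the intervals
    of the factors of each term of the expanded quasideterminant fit end to
    end, and R_I becomes the alternating sum, over the ways of forgetting some
    of the cut points prescribed by I, of the products of the h of the
    successive intervals (ribbonK_rib).  Encoding the cut points inside an
    interval by a boolean word u, this gives elements r(x, u) that satisfy the
    product rule
      r(x, u) r(x', v) = r(x, u 1 v) + r(x, u 0 v),
    x' being the cut point between u and v, and are determined by it from their
    values h on words without cuts (product_rule_uniq).

    The product rule is symmetric in its two summands, and an anti-homomorphism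
    reverses it.  Hence both
      omega (r_a (reflected x, reversed u))  and  r_(hat a) (x, complement of u)
    obey it, and complementing the reversed cut word is exactly conjugation of
    compositions (cut_word_conj).  It remains to compare them on words without
    cuts, that is, to show that omega maps the h of the reflected interval to
    the ribbon of the interval cut at every inner point.

    Such column ribbons are determined by the h through the usual relation
    sum (-1)^k h e = 0 (rib_all_cuts).  The images under omega satisfy it for the
    following reason (residue_mul, newton_orthogonality).  Expand f(t) over
    products of t - a_i that start at one end of an interval of m poles and
    g(t) over products that start at the other end.  After multiplication by
    (t - a_1) ... (t - a_m), the product of a basis element of f with k poles and
    one of g with l poles is a polynomial if k + l <= m, is 1/(t - a) for some
    pole a if k + l = m + 1, and decays faster than 1/t if k + l > m + 1.  So
    the coefficient of 1/t in f g (t - a_1) ... (t - a_m) is the convolution of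
    the two coefficient sequences, and it is 0 when f g = 1.  This is applied
    to sigma^(hat a)(t) and its inverse, the image of sigma^a(-t) under omega. *)

(** * Cut words and ribbon elements *)

(** The argument k is the length of the current block, which starts at x; a
    letter true offers a cut at x + k, with the sign of the inclusion-exclusion
    when the cut is not made.  This recursion turns a sum over all coarsenings
    into a form on which the product rule is immediate. *)
Fixpoint rib (A : nzRingType) (h : int -> nat -> A) (x : int) (k : nat)
    (w : seq bool) : A :=
  if w is b :: w' then
    if b then h x k * rib h (x + k%:Z) 1 w' - rib h x k.+1 w'
    else rib h x k.+1 w'
  else h x k.

(** A leading cut is put before every part, including the first one, so that
    concatenation of compositions is concatenation of words. *)
Definition cuts (J : seq nat) : seq bool :=
  flatten [seq true :: nseq j.-1 false | j <- J].

Definition cut_word (J : seq nat) : seq bool := behead (cuts J).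

Definition comp_rib (A : nzRingType) (h : int -> nat -> A) (x : int)
    (J : seq nat) : A :=
  if J is j :: J' then rib h x j (cuts J') else 1.

Section RibbonElements.
Variables (A : nzRingType) (h : int -> nat -> A).

Lemma rib_uncut x k m w : rib h x k (nseq m false ++ w) = rib h x (k + m) w.
Proof. by elim: m k => [|m IHm] k /=; rewrite ?addn0 // IHm addSnnS. Qed.

(** For empty u this is the clause for a letter true, whose subtracted term is
    the value for a letter false; the letters of u only carry it along. *)
Lemma rib_mul x k u v :
  rib h x k u * rib h (x + (k + size u)%N%:Z) 1 v =
  rib h x k (u ++ true :: v) + rib h x k (u ++ false :: v).
Proof.
elim: u x k => [|b u IHu] x k /=; first by rewrite addn0 subrK.
have -> : x + (k + (size u).+1)%N%:Z = x + (k.+1 + size u)%N%:Z :> int by lia.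
case: b; last exact: IHu.
rewrite mulrBl IHu -mulrA.
have -> : x + (k.+1 + size u)%N%:Z = x + k%:Z + (1 + size u)%N%:Z :> int by lia.
by rewrite IHu mulrDr opprD addrACA.
Qed.

(** The i-th term gathers the coarsenings whose first block absorbs the first i
    parts of J. *)
Lemma rib_expand x k J : all (fun j => 0 < j)%N J ->
  rib h x k (cuts J) =
  \sum_(i < (size J).+1) (-1) ^+ i *
    (h x (k + sumn (take i J))%N *
     comp_rib h (x + (k + sumn (take i J))%N%:Z) (drop i J)).
Proof.
elim: J k => [|j J IHJ] k /=.
  by rewrite big_ord1 /= addn0 expr0 mul1r mulr1.
case/andP=> j0 Jpos; rewrite !rib_uncut add1n addSnnS prednK //.
rewrite big_ord_recl /= addn0 expr0 mul1r; congr (_ + _).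
rewrite IHJ // -sumrN; apply: eq_bigr => i _.
by rewrite /= /bump add1n /= exprS mulN1r mulNr !addnA.
Qed.

Lemma comp_rib_cut_word x J : is_comp J ->
  comp_rib h x J = rib h x 1 (cut_word J).
Proof.
case: J => [|j J] //= /andP[_ /= /andP[j0 _]].
by rewrite /cut_word /= rib_uncut add1n prednK.
Qed.

End RibbonElements.

Section ProductRule.
Variable A : nzRingType.

Definition product_rule (F : int -> seq bool -> A) : Prop :=
  forall x u v, F x u * F (x + (size u).+1%:Z) v =
    F x (u ++ true :: v) + F x (u ++ false :: v).

(** The product rule expresses the value at a word with a cut by values at
    shorter words and at a word with one cut fewer, so the values at words
    without cuts determine everything. *)
Lemma product_rule_uniq F G : product_rule F -> product_rule G ->
  (forall x m, F x (nseq m false) = G x (nseq m false)) -> F =2 G.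
Proof.
move=> FM GM FG x w.
(* The prefix without cuts already read is kept as nseq m false. *)
rewrite -(cat0s w) -[[::]]/(nseq 0 false).
elim: w x 0%N => [|b w IHw] x m; first by rewrite !cats0.
have FGfalse : F x (nseq m false ++ false :: w) = G x (nseq m false ++ false :: w).
  by have := IHw x m.+1; rewrite -addn1 nseqD -catA.
case: b => //; apply: (addIr (F x (nseq m false ++ false :: w))).
rewrite -FM {1}FG FGfalse -GM; congr (_ * _).
exact: (IHw _ 0%N).
Qed.

Lemma product_rule_rib h : product_rule (fun x w => rib h x 1 w).
Proof. by move=> x u v; rewrite -rib_mul add1n. Qed.

Lemma product_rule_negb F : product_rule F ->
  product_rule (fun x w => F x (map negb w)).
Proof.
move=> FM x u v; rewrite !map_cat /= [RHS]addrC.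
by have := FM x (map negb u) (map negb v); rewrite size_map.
Qed.

End ProductRule.

(** The point - x - |u| is where the reflected word has to start for the blocks
    of u and v to remain adjacent after the reflection p |-> 1 - p of the
    points. *)
Lemma product_rule_anti (K : fieldType) (A B : algType K) (w : A -> B)
    (F : int -> seq bool -> A) :
    anti_algebra_hom w -> product_rule F ->
  product_rule (fun x u => w (F (- x - (size u)%:Z) (rev u))).
Proof.
move=> [wL _ wM] FM x u v /=; rewrite -wM.
have wD y z : w (y + z) = w y + w z by have := wL 1 y z; rewrite !scale1r.
have -> : - x - (size u)%:Z =
    - (x + (size u).+1%:Z) - (size v)%:Z + (size (rev v)).+1%:Z :> int.
  by rewrite size_rev; lia.
rewrite FM wD !size_cat !rev_cat !rev_cons !cat_rcons /=.
by have -> : - (x + (size u).+1%:Z) - (size v)%:Z =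
    - x - (size u + (size v).+1)%N%:Z :> int by lia.
Qed.

(** * The quasideterminant of a ribbon matrix *)

(** Noncommutative elimination: a column with last entry 1 that M sends to a
    multiple of the first basis vector solves the linear
    system of the minor, so no inverse needs to be computed. *)
Lemma quasidet_col (R : nzRingType) n (M : 'M[R]_n.+1) (u : 'cV[R]_n.+1) :
    (exists B, is_mxinv (row' ord0 (col' ord_max M)) B) ->
    u ord_max 0 = 1 -> (forall p, p != ord0 -> (M *m u) p 0 = 0) ->
  quasidet M ord0 ord_max = (M *m u) ord0 0.
Proof.
move=> [B invB] u1 u0; rewrite /quasidet (mxinv_eq invB).
have [_ BN] := invB.
have MuE p : (M *m u) p 0 =
    M p ord_max + (col' ord_max (row p M) *m row' ord_max u) 0 0.
  rewrite mxE (bigD1_ord ord_max) //= u1 mulr1 mxE; congr (_ + _).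
  by apply: eq_bigr => i _; rewrite !mxE.
have uE : row' ord0 (col ord_max M) =
    - (row' ord0 (col' ord_max M) *m row' ord_max u).
  apply/matrixP=> i j; rewrite ord1 !mxE; apply/eqP; rewrite -addr_eq0.
  apply/eqP; rewrite -[RHS](u0 (lift ord0 i)) // MuE !mxE; congr (_ + _).
  by apply: eq_bigr => l _; rewrite !mxE.
rewrite MuE uE mulmxN mxE opprK -mulmxA; congr (_ + _).
by rewrite (mulmxA B) BN mul1mx.
Qed.

(** The index is minus the shift: x is the starting point of the interval
    x + 1, ..., x + k of poles. *)
Definition shiftS (K : fieldType) (a : int -> K) (x : int) (k : nat) : Sym a :=
  symS_shift a (- x) k.

Lemma part_sum_take (J : seq nat) p q : (p <= q < size J)%N ->
  (part_sum J p = \sum_(p <= v < q) nth 0 J v + part_sum J q)%N.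
Proof.
move=> /andP[lepq ltq]; rewrite /part_sum -big_cat_nat //.
by rewrite -ltnS prednK // (leq_ltn_trans _ ltq).
Qed.

Lemma sumn_take_drop (J : seq nat) p i : (p + i <= size J)%N ->
  (sumn (take i (drop p J)) = \sum_(p <= v < p + i) nth 0 J v)%N.
Proof.
move=> le_pi; rewrite sumnE (big_nth 0%N) size_takel ?size_drop; last lia.
rewrite -{2}[p]add0n big_addn addKn.
rewrite big_nat [RHS]big_nat; apply: eq_bigr => v /andP[_ ltv].
by rewrite nth_take // nth_drop addnC.
Qed.

(** The column annihilated by the lower rows consists, up to sign, of the
    ribbons of the final segments of J: row p of the matrix is the expansion of
    the p-th such ribbon by its first block, and the subdiagonal 1 cancels it. *)
Lemma ribbonK_rib (K : fieldType) (a : int -> K) (J : seq nat) (s : int)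
    (k : 'I_(size J).-1.+1 -> int) :
    is_comp J -> (forall p, k p = (part_sum J p)%:Z + s) ->
  ribbonK a k = comp_rib (shiftS a) (- ((part_sum J 0)%:Z + s)) J.
Proof.
case/andP; rewrite -size_eq0 -lt0n => J0 Jpos kE.
set n := (size J).-1; have sizeJ : size J = n.+1 by rewrite prednK.
(* The ribbon of the parts from q on; R n.+1 is 1. *)
pose R (q : nat) := comp_rib (shiftS a) (- ((part_sum J q)%:Z + s)) (drop q J).
pose u : 'cV[Sym a]_n.+1 := \col_q ((-1) ^+ (n - q) * R q.+1).
have rowE (p : 'I_n.+1) :
    \sum_(q < n.+1 | (p <= q)%N) ribbon_mx a k p q * u q 0 =
    (-1) ^+ (n - p) * R p.
  have ltp : (p < size J)%N by rewrite sizeJ.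
  pose S q := shiftS a (- k p) (\sum_(p <= v < q.+1) nth 0 J v)%N.
  transitivity (\sum_(p <= q < n.+1) S q * ((-1) ^+ (n - q) * R q.+1)).
    rewrite big_geq_mkord; apply: eq_bigr => q lepq.
    by rewrite !mxE lepq /S /shiftS opprK.
  rewrite {2}/R (drop_nth 0%N) //= rib_expand; last first.
    by apply/allP=> j /mem_drop; move/allP: Jpos; apply.
  rewrite -[in LHS](add0n (p : nat)) big_addn big_mkord size_drop sizeJ.
  have -> : (n.+1 - p.+1).+1 = (n.+1 - p)%N by lia.
  rewrite mulr_sumr; apply: eq_bigr => i _.
  have lti := ltn_ord i.
  have sumE : (nth 0 J p + sumn (take i (drop p.+1 J)) =
      \sum_(p <= v < (i + p).+1) nth 0 J v)%N.
    rewrite sumn_take_drop; last by rewrite sizeJ; lia.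
    by rewrite [RHS]big_ltn ?ltnS ?leq_addl // addSn (addnC i p).
  rewrite sumE /S kE opprD.
  have -> : R (i + p).+1 = comp_rib (shiftS a)
      (- (part_sum J p)%:Z - s + (\sum_(p <= v < (i + p).+1) nth 0 J v)%N%:Z)
      (drop i (drop p.+1 J)).
    rewrite /R drop_drop addnS.
    have [ltip|geip] := ltnP (i + p).+1 (size J); last by rewrite drop_oversize.
    have := @part_sum_take J p (i + p).+1.
    rewrite ltip (leq_trans (leq_addl i p)) // => /(_ isT) ->.
    by congr comp_rib; lia.
  rewrite [in RHS]mulrA -exprD.
  have -> : (n - p + i = n - (i + p) + i * 2)%N by lia.
  rewrite exprD exprM sqrr_sign mulr1 mulrA.
  by rewrite (commr_sign (shiftS _ _ _)) mulrA.
rewrite /ribbonK (@quasidet_col _ _ _ u).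
- have -> : (ribbon_mx a k *m u) ord0 0 = (-1) ^+ (n - 0) * R 0%N.
    by rewrite mxE -(rowE ord0); apply: eq_bigl.
  by rewrite subn0 mulrA -exprD addnn -signr_odd odd_double mul1r /R drop0.
- exact: ribbon_minor_inv.
- by rewrite mxE subnn expr0 mul1r /R drop_oversize // sizeJ.
move=> p p0; rewrite mxE (bigID (fun q : 'I_n.+1 => p <= q)%N) /= rowE.
have {p0} p0 : (0 < p)%N by rewrite lt0n.
have ltp : (p.-1 < n.+1)%N by rewrite prednK // ltnW.
rewrite (bigD1 (Ordinal ltp)) /=; last by rewrite -ltnNge prednK.
rewrite big1 => [|q /andP[leqp neqp]]; last first.
  rewrite !mxE (negbTE leqp); case: eqP => [eqp|]; last by rewrite mul0r.
  by case/eqP: neqp; apply: val_inj; rewrite /= eqp.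
rewrite [X in _ + X]addr0 [ribbon_mx _ _ _ _]mxE [u _ _]mxE.
rewrite [nat_of_ord (Ordinal _)]/= leqNgt prednK // leqnn eqxx mul1r.
have -> : (n - p.-1 = (n - p).+1)%N by have := ltn_ord p; lia.
by rewrite exprS mulN1r mulNr subrr.
Qed.

(** * Residues of series over shifted factorials *)

Section ClearPoles.
Variables (K : fieldType) (A : algType K).
Implicit Types (f g : nat -> A) (s : seq K).

(** Multiplication by 1 - c/t, which cancels a factor t - c of a denominator
    up to a power of t. *)
Definition clear_pole (c : K) f : nat -> A :=
  fun n => f n - (if n is n'.+1 then c *: f n' else 0).

Definition clear_poles s f : nat -> A := foldr clear_pole f s.

Definition div_t f : nat -> A := fun n => if n is n'.+1 then f n' else 0.

Definition ser_const (x : A) : nat -> A := fun n => if n is 0 then x else 0.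

Lemma eq_clear_pole c f g : f =1 g -> clear_pole c f =1 clear_pole c g.
Proof. by move=> fg [|n]; rewrite /clear_pole !fg. Qed.

Lemma eq_clear_poles s f g : f =1 g -> clear_poles s f =1 clear_poles s g.
Proof. by move=> fg; elim: s => //= c s; apply: eq_clear_pole. Qed.

Lemma clear_poleC c d f :
  clear_pole c (clear_pole d f) =1 clear_pole d (clear_pole c f).
Proof.
case=> [|[|n]]; rewrite /clear_pole ?subr0 ?scalerBr ?scaler0 ?scalerA //.
  by rewrite addrAC.
by rewrite !opprB (mulrC c) addrACA [RHS]addrACA; congr (_ + _); apply: addrC.
Qed.

Lemma clear_poles_rcons s c f :
  clear_poles (rcons s c) f =1 clear_poles (c :: s) f.
Proof.
elim: s => //= d s IHs n.
by rewrite (eq_clear_pole d IHs) /= clear_poleC.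
Qed.

Lemma clear_poles_cons s c f :
  clear_poles (c :: s) f =1 clear_poles s (clear_pole c f).
Proof.
by move=> n; rewrite -clear_poles_rcons /clear_poles foldr_rcons.
Qed.

Lemma clear_poles_rev s f : clear_poles (rev s) f =1 clear_poles s f.
Proof.
elim: s => // c s IHs n; rewrite rev_cons clear_poles_rcons /=.
exact: eq_clear_pole.
Qed.

Lemma clear_poles_add s f g n :
  clear_poles s (fun i => f i + g i) n = clear_poles s f n + clear_poles s g n.
Proof.
elim: s n => //= c s IHs n; rewrite /clear_pole IHs.
by case: n => [|n]; rewrite ?subr0 // IHs scalerDr opprD addrACA.
Qed.

Lemma clear_poles_mull s x f n :
  clear_poles s (fun i => x * f i) n = x * clear_poles s f n.
Proof.
elim: s n => //= c s IHs n; rewrite /clear_pole IHs.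
by case: n => [|n]; rewrite ?subr0 // IHs mulrBr scalerAr.
Qed.

Lemma clear_poles_div_t s f : clear_poles s (div_t f) =1 div_t (clear_poles s f).
Proof.
elim: s => //= c s IHs n; rewrite (eq_clear_pole c IHs).
by case: n => [|[|n]]; rewrite /clear_pole /= ?scaler0 ?subr0.
Qed.

Lemma clear_poles_degree s f d : (forall n, (d < n)%N -> f n = 0) ->
  forall n, (d + size s < n)%N -> clear_poles s f n = 0.
Proof.
move=> f0; elim: s => [|c s IHs] n /=; first by rewrite addn0; apply: f0.
case: n => // n; rewrite addnS ltnS => ltn.
by rewrite /clear_pole !IHs ?scaler0 ?subr0 // ltnW.
Qed.

Lemma clear_pole_mul c f g :
  clear_pole c (ser_mul f g) =1 ser_mul (clear_pole c f) g.
Proof.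
case=> [|n]; rewrite /clear_pole /ser_mul.
  by rewrite !big_ord1 !subr0.
rewrite scaler_sumr; under [RHS]eq_bigr do rewrite mulrBl.
rewrite sumrB; congr (_ - _).
rewrite [RHS]big_ord_recl /= mul0r add0r; apply: eq_bigr => i _.
by rewrite scalerAl /bump.
Qed.

Lemma ser_const_mul x f : ser_mul (ser_const x) f =1 (fun n => x * f n).
Proof.
move=> n; rewrite /ser_mul big_ord_recl subn0 big1 ?addr0 // => i _.
by rewrite /= mul0r.
Qed.

Lemma ser_mul_div_t f g : ser_mul (div_t f) g =1 div_t (ser_mul f g).
Proof.
case=> [|n]; rewrite /ser_mul /div_t; first by rewrite big_ord1 mul0r.
by rewrite big_ord_recl mul0r add0r.
Qed.

Lemma ser_mulDl f f' g n :
  ser_mul (fun i => f i + f' i) g n = ser_mul f g n + ser_mul f' g n.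
Proof. by rewrite -big_split; apply: eq_bigr => i _; rewrite mulrDl. Qed.

End ClearPoles.

Section Residues.
Variable K : fieldType.
Implicit Types (a b : int -> K).

Definition poles a (m : nat) : seq K := [seq a i%:Z | i <- iota 1 m].

Lemma polesS a m : poles a m.+1 = a 1 :: poles (shift_seq 1 a) m.
Proof.
rewrite /poles /= (iotaDl 1 1) -map_comp; congr cons.
by apply: eq_map => i; rewrite /= /shift_seq addrC.
Qed.

Lemma poles_rev a b m : (forall i, b i = a (m.+1%:Z - i)) ->
  poles b m = rev (poles a m).
Proof.
move=> ba; apply: (@eq_from_nth _ 0); rewrite ?size_rev !size_map // size_iota.
move=> i ltim; rewrite nth_rev !size_map size_iota //.
rewrite !(nth_map 0%N) ?size_iota ?nth_iota ?ba; try lia.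
by congr a; lia.
Qed.

(** The products over a grow at their last pole by definition; this peels off
    the first one instead. *)
Lemma inv_ffact_clear a k :
  clear_pole (a 1) (inv_ffact a k.+1 : nat -> K^o) =1
  div_t (inv_ffact (shift_seq 1 a) k : nat -> K^o).
Proof.
elim: k => [|k IHk] n.
  have invE : inv_ffact a 1 =1 ser_invlin (a 1) := ser_1mul _.
  rewrite (eq_clear_pole _ (invE : _ =1 (_ : nat -> K^o))).
  case: n => [|[|n]]; rewrite /clear_pole /div_t /= ?subr0 //.
    by rewrite scaler0 subr0.
  by rewrite exprS subrr.
rewrite [inv_ffact _ _]/= (clear_pole_mul _ (_ : nat -> K^o) _ n).
rewrite (eq_ser_mul IHk (frefl _)) ser_mul_div_t.
by case: n => //= n; rewrite /shift_seq -PoszD addn1.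
Qed.

Variable A : algType K.
Implicit Types c d : nat -> A.

(** Horner form of the expansion:
    f = c_0 + (1/(t - a_1)) f', where f' has the shifted coefficients over the
    shifted poles. *)
Lemma newton_step a c :
  clear_pole (a 1) (ffact_series a c) =1
  (fun n => clear_pole (a 1) (ser_const (c 0%N)) n +
            div_t (ffact_series (shift_seq 1 a) (c \o succn)) n).
Proof.
have splitE n : ffact_series a c n =
    ser_const (c 0%N) n + \sum_(k < n.+1) inv_ffact a k.+1 n *: c k.+1.
  rewrite big_ord_recr (inv_ffact_lt a (ltnSn n)) scale0r Monoid.mulm1.
  rewrite /ffact_series big_ord_recl; congr (_ + _).
  by case: n => [|n]; rewrite /= ?scale1r ?scale0r.
case=> [|n]; rewrite /clear_pole !splitE.
  by rewrite !subr0 big_ord1 (inv_ffact_lt a (ltnSn 0)) scale0r.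
rewrite scalerDr opprD addrACA; congr (_ + _).
rewrite [X in _ - _ *: X](_ : _ =
    \sum_(k < n.+2) inv_ffact a k.+1 n *: c k.+1); last first.
  rewrite [RHS]big_ord_recr (inv_ffact_lt a (ltnW (ltnSn n.+1))).
  by rewrite scale0r Monoid.mulm1.
rewrite scaler_sumr -sumrB big_ord_recr.
rewrite (inv_ffact_lt a (ltnSn n.+1)) (inv_ffact_lt a (ltnW (ltnSn n.+1))).
rewrite !scale0r scaler0 subr0 Monoid.mulm1.
apply: eq_bigr => k _; rewrite scalerA -scalerBl; congr (_ *: _).
exact: (inv_ffact_clear a k n.+1).
Qed.

(** c_(m+1) is the coefficient of 1/t in f(t) (t - a_1) ... (t - a_m), read off
    here as the coefficient of t^(-m-1) after division by t^m. *)
Lemma residue_coef a c m :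
  clear_poles (poles a m) (ffact_series a c) m.+1 = c m.+1.
Proof.
elim: m a c => [|m IHm] a c.
  by rewrite /= ffact_series_rec big_ord1 /= /ser_one /= scale0r add0r.
rewrite polesS clear_poles_cons (eq_clear_poles _ (newton_step a c)).
rewrite clear_poles_add clear_poles_div_t /= IHm -clear_poles_cons.
rewrite (@clear_poles_degree _ _ _ _ 0) ?add0r //; first by case.
by rewrite /= size_map size_iota.
Qed.

(** The poles b_1, ..., b_m are a_m, ..., a_1.  Removing a_1 from f by its
    Horner form leaves two terms: c_0 g with all poles cleared, which gives a
    coefficient of g, and the same problem for the remaining poles. *)
Lemma residue_mul a b c d m : (forall i, b i = a (m.+1%:Z - i)) ->
  clear_poles (poles a m) (ser_mul (ffact_series a c) (ffact_series b d)) m.+1 =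
  \sum_(k < m.+2) c k * d (m.+1 - k)%N.
Proof.
elim: m a c => [|m IHm] a c ba.
  rewrite /= /ser_mul !big_ord_recr big_ord0 /= !ffact_series_rec.
  by rewrite !big_ord_recr !big_ord0 /= /ser_one /= !scale0r !add0r.
have polesE : poles b m.+1 = rev (a 1 :: poles (shift_seq 1 a) m).
  by rewrite -polesS; apply: poles_rev.
rewrite polesS clear_poles_cons (eq_clear_poles _ (clear_pole_mul _ _ _)).
rewrite (eq_clear_poles _ (eq_ser_mul (newton_step a c) (frefl _))).
rewrite (eq_clear_poles _ (ser_mulDl _ _ _)) clear_poles_add.
rewrite (eq_clear_poles _ (ser_mul_div_t _ _)) clear_poles_div_t [div_t _ _]/=.
rewrite IHm => [|i]; last by rewrite ba /shift_seq; congr a; lia.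
rewrite [RHS]big_ord_recl subn0; congr (_ + _).
rewrite -(eq_clear_poles _ (clear_pole_mul _ _ _)) -clear_poles_cons.
rewrite (eq_clear_poles _ (ser_const_mul _ _)) clear_poles_mull.
by rewrite -clear_poles_rev -polesE residue_coef.
Qed.

(** If f g = 1, then residue_mul computes the coefficient of 1/t in a
    polynomial in t. *)
Lemma newton_orthogonality a b c d m :
    (forall i, b i = a (m.+1%:Z - i)) ->
    ser_mul (ffact_series a c) (ffact_series b d) =1 ser_one A ->
  \sum_(k < m.+2) c k * d (m.+1 - k)%N = 0.
Proof.
move=> ba cd; rewrite -(residue_mul _ _ ba) (eq_clear_poles _ cd).
rewrite (@clear_poles_degree _ _ _ _ 0) //; first by case.
by rewrite size_map size_iota.
Qed.

Lemma inv_ffact_negt a k :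
  inv_ffact (fun i => - a i) k =1
  (fun n => (-1) ^+ k * ser_negt (inv_ffact a k) n).
Proof.
have invlinN (x : K) j : ser_invlin (- x) j = - ser_negt (ser_invlin x) j.
  case: j => [|j]; rewrite /ser_negt /= ?mulr0 ?oppr0 //.
  by rewrite (exprNn x) (exprS (-1)); ring.
elim: k => [|k IHk] n; first by rewrite /= mul1r ser_negt_one.
rewrite [in RHS]/= -ser_negt_mul /= /ser_mul mulr_sumr.
by apply: eq_bigr => i _; rewrite IHk invlinN exprS; ring.
Qed.

(** 1/(- t - a_i) is - 1/(t - (- a_i)): the change of t into - t negates the
    poles. *)
Lemma ffact_series_negt a c :
  ser_negt (ffact_series a c) =1
  ffact_series (fun i => - a i) (fun k => (-1) ^+ k * c k).
Proof.
move=> n; rewrite /ser_negt mulr_sumr; apply: eq_bigr => k _.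
rewrite inv_ffact_negt /ser_negt -(signr_odd A n) -(signr_odd A k).
rewrite -(signr_odd K n) -(signr_odd K k).
case: (odd n); case: (odd k); rewrite ?expr0 ?expr1 ?mul1r ?mulN1r ?mulrN1 //;
  by rewrite ?opprK ?scaleNr ?scalerN ?opprK.
Qed.

End Residues.

(** * The dual elementary functions *)

(** Expanding by the first block is the recursion that the orthogonality
    relation imposes on e. *)
Lemma rib_all_cuts (A : nzRingType) (h e : int -> nat -> A) :
    (forall x, h x 0%N = 1) -> (forall x, e x 0%N = 1) ->
    (forall x n, (0 < n)%N ->
       \sum_(k < n.+1) (-1) ^+ k * (h x k * e (x + k%:Z) (n - k)%N) = 0) ->
  forall x n, rib h x 1 (nseq n true) = e x n.+1.
Proof.
move=> h0 e0 orth x n; elim/ltn_ind: n x => n IHn x.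
have cutsE m : nseq m true = cuts (nseq m 1%N).
  by elim: m => //= m ->.
have comp_ribE y m : (m <= n)%N -> comp_rib h y (nseq m 1%N) = e y m.
  case: m => [|m] ltm; first by rewrite /= e0.
  by rewrite /= -cutsE IHn.
rewrite cutsE rib_expand; last by apply/allP=> j /nseqP[-> _].
have := orth x n.+1 isT.
rewrite big_ord_recl /= expr0 h0 !mul1r subn0 addr0 => /eqP.
rewrite addr_eq0 => /eqP ->; rewrite -sumrN size_nseq.
apply: eq_bigr => i _; have lein : (i <= n)%N by rewrite -ltnS.
rewrite /bump /= !add1n exprS mulN1r mulNr opprK subSS.
by rewrite drop_nseq take_nseq // sumn_nseq mul1n comp_ribE ?leq_subr.
Qed.

Lemma shiftSP (K : fieldType) (a : int -> K) x :
  ffact_series (shift_seq x a) (shiftS a x) =1 sigma a.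
Proof. by move=> n; have := symS_shiftP a (- x) n; rewrite opprK. Qed.

Lemma shiftS0 (K : fieldType) (a : int -> K) x : shiftS a x 0%N = 1.
Proof. by rewrite -(ffact_series0 (shift_seq x a)) shiftSP sigma0. Qed.

Section DualBasis.
Variables (K : fieldType) (A B : algType K) (w : A -> B).
Hypothesis w_hom : anti_algebra_hom w.

Lemma anti_hom_inverse (a : int -> K) (S : nat -> A) (f L : nat -> B) :
    is_dual (hat (hat a)) f L -> (forall k, w (S k) = L k) ->
  ser_mul f (ser_negt (fun n => w (ffact_series a S n))) =1 ser_one B.
Proof.
move=> [_ _ fL] wS n; rewrite -fL.
apply: eq_ser_mul => [//|]; apply: eq_ser_negt => {}n.
rewrite (anti_hom_ffact w_hom); apply: eq_ffact_series => [i|//].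
by rewrite /hat opprK opprD opprK addrK.
Qed.

(** An interval that starts at x for hat a and one that starts at
    1 - x - n for a traverse, up to sign, the same poles from
    opposite ends, apart from one extra pole at the far end of each. *)
Lemma dual_orthogonality (a : int -> K) (h : int -> nat -> A)
    (h' : int -> nat -> B) (f : nat -> A) (f' : nat -> B) :
    (forall x, ffact_series (shift_seq x a) (h x) =1 f) ->
    (forall x, ffact_series (shift_seq x (hat a)) (h' x) =1 f') ->
    ser_mul f' (ser_negt (fun n => w (f n))) =1 ser_one B ->
  forall x n, (0 < n)%N ->
  \sum_(k < n.+1) (-1) ^+ k *
    (h' x k * w (h (1 - (x + k%:Z) - (n - k)%N%:Z) (n - k)%N)) = 0.
Proof.
move=> hE h'E inv x [//|m] _; set y := 1 - x - m.+1%:Z.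
pose c k := (-1) ^+ k * w (h y k).
have negE : ser_negt (fun n => w (f n)) =1
    ffact_series (fun i => - shift_seq y a i) c.
  move=> n; rewrite -ffact_series_negt; apply: eq_ser_negt => {}n.
  by rewrite -(anti_hom_ffact w_hom) hE.
have prod1 : ser_mul (ffact_series (shift_seq x (hat a)) (h' x))
    (ffact_series (fun i => - shift_seq y a i) c) =1 ser_one B.
  by move=> n; rewrite -inv; apply: eq_ser_mul => // i; rewrite negE.
have indexE (i : int) :
    - shift_seq y a i = shift_seq x (hat a) (m.+1%:Z - i).
  by rewrite /shift_seq /hat; congr (- a _); rewrite /y; lia.
rewrite -[RHS](mulr0 ((-1) ^+ m.+1)).
rewrite -[X in _ = _ * X](newton_orthogonality indexE prod1).
rewrite mulr_sumr; apply: eq_bigr => k _.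
have lek : (k <= m.+1)%N by rewrite -ltnS.
have -> : 1 - (x + k%:Z) - (m.+1 - k)%N%:Z = y :> int by rewrite /y; lia.
rewrite /c (mulrA (h' x k)) (commr_sign (h' x k)) -(mulrA _ (h' x k)).
rewrite [RHS]mulrA -exprD.
congr (_ * _).
have -> : (m.+1 + (m.+1 - k) = k + (m.+1 - k) * 2)%N by lia.
by rewrite exprD exprM sqrr_sign mulr1.
Qed.

(** Both sides obey the product rule, so only words without cuts matter; there
    the left side is the image of a complete function and the right side a
    ribbon with all cuts. *)
Lemma rib_duality (h : int -> nat -> A) (h' : int -> nat -> B) :
    (forall x, h x 0%N = 1) -> (forall x, h' x 0%N = 1) ->
    (forall x n, (0 < n)%N ->
       \sum_(k < n.+1) (-1) ^+ k *
         (h' x k * w (h (1 - (x + k%:Z) - (n - k)%N%:Z) (n - k)%N)) = 0) ->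
  forall x u, w (rib h (- x - (size u)%:Z) 1 (rev u)) = rib h' x 1 (map negb u).
Proof.
move=> h0 h'0 orth; have [_ w1 _] := w_hom.
apply: (product_rule_uniq (product_rule_anti w_hom (product_rule_rib h))
  (product_rule_negb (product_rule_rib h'))) => x m.
rewrite map_nseq (@rib_all_cuts _ _ (fun y n => w (h (1 - y - n%:Z) n))) //.
  rewrite rev_nseq size_nseq -[nseq m false]cats0 rib_uncut add1n /=.
  by congr (w (h _ _)); lia.
by move=> y; rewrite h0.
Qed.

End DualBasis.

(** * Conjugate compositions *)

(** From left to right, unlike conj_comp: in this order the diagram is built by
    adding first rows. *)
Definition col_heights (I : seq nat) : seq nat :=
  [seq col_height I c | c <- iota 0 (ncols I)].

Lemma row_start_cons i I l : row_start (i :: I) l.+1 = (i.-1 + row_start I l)%N.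
Proof. by []. Qed.

(** The new first row adds columns of height one on the left, and one box on
    top of the first column of the remaining diagram, with which it shares its
    last column.  For empty I, a single empty column plays the part of the
    diagram. *)
Lemma col_heights_cons i I : all (fun i => 0 < i)%N (i :: I) ->
  col_heights (i :: I) =
  nseq i.-1 1%N ++ (head 0 (col_heights I)).+1 :: behead (col_heights I).
Proof.
move=> /= /andP[i0 Ipos].
have heightE c : col_height (i :: I) c =
    ((c < i) + if (i.-1 <= c) then col_height I (c - i.-1) else 0)%N.
  rewrite /col_height /= {1}/row_start /= add0n; congr (_ + _)%N.
  rewrite (iotaDl 1 0) count_map.
  case: leqP => [le_ic|lt_ci]; last first.
    apply/eqP; rewrite -leqn0 leqNgt -has_count; apply/hasPn=> l _ /=.
    by rewrite row_start_cons leqNgt (leq_trans lt_ci) ?leq_addr.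
  apply: eq_count => l; rewrite /= row_start_cons add0n -addnA.
  by congr andb; lia.
have ncolsE : ncols (i :: I) = (i.-1 + ncols I)%N.
  by rewrite /ncols /= row_start_cons addnS.
rewrite /col_heights ncolsE iotaD map_cat add0n; congr (_ ++ _).
  apply/(@eq_from_nth _ 0%N); rewrite size_map size_iota ?size_nseq // => c ltc.
  rewrite (nth_map 0%N) ?size_iota // nth_iota // nth_nseq ltc heightE add0n.
  by rewrite (leqNgt i.-1) ltc /= addn0; lia.
rewrite /ncols /= heightE leqnn subnn ltn_predL i0 add1n; congr cons.
rewrite -[i.-1.+1]addn1 iotaDl -map_comp; apply/eq_in_map => c.
rewrite mem_iota => /andP[c0 _] /=.
by rewrite heightE leq_addr addKn; case: ltnP => //; lia.
Qed.

Lemma conj_compE I : conj_comp I = rev (col_heights I).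
Proof. by []. Qed.

Lemma cuts_cat I J : cuts (I ++ J) = cuts I ++ cuts J.
Proof. by rewrite /cuts map_cat flatten_cat. Qed.

Lemma cut_word_rev J : cut_word (rev J) = rev (cut_word J).
Proof.
(* A final cut makes the words symmetric under reversal. *)
have cutsR I : rcons (cuts (rev I)) true = true :: rev (cuts I).
  elim: I => // i I IHI; rewrite rev_cons -[rcons (rev I) i]cats1 cuts_cat.
  rewrite -cats1 -catA /= cats0 -cat_rcons IHI rev_cons rev_cat rev_nseq.
  by rewrite -cats1 -catA.
case: J => // j J; have := cutsR (j :: J).
have -> : cuts (j :: J) = true :: cut_word (j :: J) by [].
by rewrite (rev_cons true) -rcons_cons => /rcons_inj[E]; rewrite {1}/cut_word E.
Qed.

Lemma col_heights_pos I : is_comp I -> all (fun j => 0 < j)%N (col_heights I).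
Proof.
case/andP; elim: I => // i I IHI _ Ipos; rewrite col_heights_cons //.
rewrite all_cat all_nseq orbT.
case: I IHI Ipos => // i' I IHI /andP[_ Ipos]; have := IHI isT Ipos.
by case: (col_heights _) => //= h s /andP[].
Qed.

Lemma conj_comp_is_comp I : is_comp I -> is_comp (conj_comp I).
Proof.
move=> Icomp; rewrite /is_comp conj_compE all_rev col_heights_pos // andbT.
by rewrite -size_eq0 size_rev size_map size_iota.
Qed.

(** Walking along the ribbon, a step stays in a row exactly when it leaves a
    column. *)
Lemma cut_word_col_heights I : is_comp I ->
  cut_word (col_heights I) = map negb (cut_word I).
Proof.
have onesE m : cuts (nseq m 1%N) = nseq m true by elim: m => //= m <-.
have nseqS m : rcons (nseq m true) true = nseq m.+1 true.
  by elim: m => //= m ->.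
case/andP; elim: I => // i I IHI _ Ipos; rewrite col_heights_cons //.
rewrite {1}/cut_word cuts_cat onesE.
case: I IHI Ipos => [|i' I] IHI Ipos.
  by rewrite /cut_word /= !cats0 map_nseq cats1 nseqS.
have /andP[_ Ipos'] := Ipos; have {IHI} := IHI isT Ipos'.
have := @col_heights_pos (i' :: I) Ipos'.
have : size (col_heights (i' :: I)) != 0%N by rewrite size_map size_iota.
case: (col_heights _) => [|[|h] s] // _ _ IH.
have -> : cut_word [:: i, i' & I] = nseq i.-1 false ++ true :: cut_word (i' :: I).
  by [].
rewrite map_cat map_nseq map_cons -IH.
rewrite -[cuts _]/[:: true, false & cut_word (h.+1 :: s)].
by rewrite -cat_rcons nseqS.
Qed.

Lemma cut_word_conj I : is_comp I ->
  cut_word (conj_comp I) = map negb (rev (cut_word I)).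
Proof.
by move=> Icomp; rewrite conj_compE cut_word_rev cut_word_col_heights // map_rev.
Qed.

Lemma size_cut_word I : is_comp I -> (size (cut_word I)).+1 = sumn I.
Proof.
have sizeE J : all (fun i => 0 < i)%N J -> size (cuts J) = sumn J.
  elim: J => //= j J IHJ /andP[j0 Jpos].
  by rewrite size_cat size_nseq IHJ // -addSn prednK.
by case: I => // i I /andP[_ Ipos]; rewrite -sizeE.
Qed.

Lemma part_sum_last I : I != [::] -> (part_sum I 0 + last 0%N I = sumn I)%N.
Proof.
rewrite -size_eq0 -lt0n => I0; rewrite sumnE (big_nth 0%N) -[size I in RHS]prednK //.
by rewrite big_nat_recr //= nth_last.
Qed.

(** * Ribbons under the anti-isomorphism *)

Theorem corollary32 (K : fieldType) (K_char0 : [pchar K] =i pred0)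
    (a : int -> K) (omega : Sym a -> Sym (hat a)) :
  anti_algebra_iso omega ->
  (forall k : nat, (1 <= k)%N -> omega (symS a k) = symL (hat a) k) ->
  forall I : seq nat, is_comp I ->
    omega (ribbon a I) =
    ribbon_shift (hat a) (conj_comp I)
      ((last 0%N (conj_comp I))%:Z - (sumn (conj_comp I))%:Z
        + (last 0%N I)%:Z - 1).
Proof.
move=> [w_hom _] wS I Icomp; set J := conj_comp I.
have Jcomp : is_comp J := conj_comp_is_comp Icomp.
have [L0 _ _] := symLP (hat a); have [_ w1 _] := w_hom.
have wS0 k : omega (symS a k) = symL (hat a) k.
  by case: k => [|k]; [rewrite w1 L0 | apply: wS].
have inv : ser_mul (sigma (hat a)) (ser_negt (fun n => omega (sigma a n))) =1
    ser_one (Sym (hat a)).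
  exact: anti_hom_inverse (symLP (hat a)) wS0.
have orth := dual_orthogonality w_hom (@shiftSP K a) (@shiftSP K (hat a)) inv.
have duality := rib_duality w_hom (@shiftS0 K a) (@shiftS0 K (hat a)) orth.
have last_sum L : is_comp L ->
    (part_sum L 0)%:Z = (sumn L)%:Z - (last 0%N L)%:Z :> int.
  by case/andP=> Ln0 _; rewrite -(part_sum_last Ln0); lia.
rewrite /ribbon (@ribbonK_rib _ _ _ 0) // => [|p]; last by rewrite addr0.
rewrite /ribbon_shift (ribbonK_rib _ Jcomp (fun=> erefl _)).
rewrite (comp_rib_cut_word (shiftS a) _ Icomp).
rewrite (comp_rib_cut_word (shiftS (hat a)) _ Jcomp).
rewrite [cut_word J]cut_word_conj // -[cut_word I in LHS]revK.
have -> : - ((part_sum I 0)%:Z + 0) =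
    - (1 - (last 0%N I)%:Z) - (size (rev (cut_word I)))%:Z :> int.
  by rewrite last_sum // -size_cut_word // size_rev; lia.
rewrite duality; congr (rib _ _ _ _); rewrite last_sum //; lia.
Qed.
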